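(* Let $L/K$ be a finite Galois extension of local fields with group $G$ and let $\alpha\in L_K^\times$. For each $s\in G$ let $\beta_s\in L_K^\times$ be such that $\sigma(\beta_s)/\beta_s=s(\alpha)/\alpha$, with $\beta_1=1$, and put $$a_{s,t}=s(\beta_t)\,\beta_{st}^{-1}\,\beta_s\qquad (s,t\in G),$$ a normalized $2$-cocycle of $G$ with values in $L^\times$. Then the endomorphism algebra $D_K(\alpha)$ of the $F$-isocrystal $L_K(\alpha)$ is isomorphic to the crossed product algebra associated to the $2$-cocycle $(a_{s,t})$. Moreover the extension of $G$ by $L^\times$ corresponding to $D_K(\alpha)$ is isomorphic to $$1\to L^\times\xrightarrow{\ i\ }W(\alpha)\xrightarrow{\ p\ }G\to 1,$$ where $W(\alpha)$ is the set of pairs $(\beta,s)\in L_K^\times\times G$ satisfying $\sigma(\beta)/\beta=s(\alpha)/\alpha$, with the composition law $$(\beta,s)(\gamma,t)=(\beta\cdot s(\gamma),\,st),$$ and $i$, $p$ are the evident inclusion $\ell\mapsto(1\otimes\ell,1)$ and projection $(\beta,s)\mapsto s$.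
   Context: A local field is a complete discretely valued nonarchimedean field with finite residue field (of characteristic $0$ or $p$). $K$ is a local field whose residue field has $q$ elements. $K^{nr}$ is a fixed completion of the maximal unramified extension of $K$, and $\sigma$ is the unique automorphism of $K^{nr}$ inducing the $q$th power map on the residue field and having fixed field $K$. For a finite extension $L/K$ put $L_K=K^{nr}\otimes_K L$; $\sigma$ also denotes $\sigma\otimes\mathrm{id}_L$ on $L_K$. If $L/K$ is Galois with group $G$, then $G$ acts on $L_K$ through the factor $L$, commuting with $\sigma$. $L^\times$ is regarded as a subgroup of $L_K^\times$ by $\ell\mapsto 1\otimes\ell$; elements $\beta_s$ as in the claim always exist and are unique up to factors in $L^\times$. An $F$-isocrystal on $K^{nr}$ is a finite-dimensional $K^{nr}$-vector space $V$ with a $\sigma$-linear automorphism $F$; morphisms are $K^{nr}$-linear maps compatible with the $F$'s. For $\alpha\in L_K^\times$, $L_K(\alpha)$ is the $F$-isocrystal $(L_K,F_\alpha)$ with $F_\alpha(x)=\alpha\cdot\sigma(x)$, and $D_K(\alpha)$ is its endomorphism ring (a $K$-algebra). Multiplication by $1\otimes\ell$ gives an embedding $i:L\to D_K(\alpha)$ of $K$-algebras. The crossed product algebra associated to a normalized 2-cocycle $(a_{s,t})$ is $\bigoplus_{s\in G}L\,u_s$ with multiplication determined by $u_su_t=a_{s,t}u_{st}$ and $u_s\ell=s(\ell)u_s$ for $\ell\in L$, $s,t\in G$. The extension of $G$ by $L^\times$ corresponding to $D_K(\alpha)$ is the group of all $u\in D_K(\alpha)^\times$ for which there is $s\in G$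 with $u\,i(\ell)\,u^{-1}=i(s(\ell))$ for all $\ell\in L$, with the map $u\mapsto s$ to $G$ and the subgroup $i(L^\times)$ as kernel. *)

(* Defs.v *)
From HB Require Import structures.
From mathcomp Require Import all_boot all_order all_algebra.
From mathcomp Require Import all_fingroup all_solvable all_field.
From mathcomp Require Import boolp.

Set Implicit Arguments.
Unset Strict Implicit.
Unset Printing Implicit Defensive.
Import Order.TTheory GRing.Theory Num.Theory.
Local Open Scope ring_scope.

(* Normalized discrete valuations; the value at 0, morally +oo, is junk and
   is never used: see [val_ge]. *)
Record discrete_valuation (F : fieldType) := DiscreteValuation {
  dval :> F -> int;
  dvalM : forall x y, x != 0 -> y != 0 -> dval (x * y) = dval x + dval y;
  dvalD : forall x y, x != 0 -> y != 0 -> x + y != 0 ->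
    Num.min (dval x) (dval y) <= dval (x + y);
  dval_onto : exists2 x, x != 0 & dval x = 1 }.

Definition val_ge (F : fieldType) (v : discrete_valuation F) (n : int) (x : F) :=
  (x == 0) || (n <= v x).

Definition val_complete (F : fieldType) (v : discrete_valuation F) :=
  forall u : nat -> F,
    (forall n : int, exists N : nat, forall i j : nat,
        (N <= i)%N -> (N <= j)%N -> val_ge v n (u i - u j)) ->
    exists l : F, forall n : int, exists N : nat, forall i : nat,
        (N <= i)%N -> val_ge v n (u i - l).

(* The residue field of v (the ring [val_ge v 0] modulo the ideal
   [val_ge v 1]) has exactly q elements: r lists one representative in each
   residue class. *)
Definition residue_card (F : fieldType) (v : discrete_valuation F) (q : nat) :=
  exists r : 'I_q -> F,
    (forall i, val_ge v 0 (r i)) /\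
    (forall x, val_ge v 0 x -> exists! i, val_ge v 1 (x - r i)).

Definition local_field (K : fieldType) (v : discrete_valuation K) (q : nat) :=
  val_complete v /\ residue_card v q.

Definition val_extends (E F : fieldType) (v : discrete_valuation E)
    (w : discrete_valuation F) (j : {rmorphism E -> F}) :=
  forall x, x != 0 -> w (j x) = v x.

(* Both valuations are normalized, so [val_extends] says that the ramification
   index is 1.  The other half of the usual definition, separability of the
   residue extension, is automatic here since the residue field of K is finite,
   hence perfect. *)
Definition unramified (K E : fieldType) (v : discrete_valuation K)
    (w : discrete_valuation E) (j : {rmorphism K -> E}) :=
  (forall y, algebraicOver j y) /\ val_extends v w j.

Definition maximal_unramified (K E : fieldType) (v : discrete_valuation K)
    (w : discrete_valuation E) (j : {rmorphism K -> E}) :=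
  unramified v w j /\
  forall (E' : fieldType) (w' : discrete_valuation E') (j' : {rmorphism E -> E'}),
    val_extends w w' j' -> unramified v w' (j' \o j) ->
    forall y, exists x, y = j' x.

Definition completion_of (E F : fieldType) (v : discrete_valuation E)
    (w : discrete_valuation F) (c : {rmorphism E -> F}) :=
  [/\ val_extends v w c, val_complete w
    & forall (y : F) (n : int), exists x : E, val_ge w n (y - c x)].

Definition completed_maximal_unramified (K Knr : fieldType)
    (v : discrete_valuation K) (w : discrete_valuation Knr)
    (iota : {rmorphism K -> Knr}) :=
  exists (E : fieldType) (wE : discrete_valuation E)
         (j : {rmorphism K -> E}) (c : {rmorphism E -> Knr}),
    [/\ maximal_unramified v wE j, completion_of wE w c & iota =1 c \o j].

Record frobenius (K Knr : fieldType) (w : discrete_valuation Knr)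
    (iota : {rmorphism K -> Knr}) (q : nat) := Frobenius {
  frob :> {rmorphism Knr -> Knr};
  frob_bij : bijective frob;
  frob_residue : forall x, val_ge w 0 x -> val_ge w 1 (frob x - x ^+ q);
  frob_fixed : forall x, frob x = x <-> exists a, x = iota a }.

(* K^nr (x)_K L, for L/K finite: elements are given by their K^nr-coordinates
   in the basis 1 (x) e_i, where (e_i) is a K-basis of L.  The universal
   property is [tensor_universal] below. *)
Definition tensor (K Knr : fieldType) (iota : {rmorphism K -> Knr})
    (L : fieldExtType K) : Type := 'rV[Knr]_(\dim {:L}).

Section Tensor.
Variables (K Knr : fieldType) (iota : {rmorphism K -> Knr}).
Variable L : fieldExtType K.
Local Notation n := (\dim {:L}).
Local Notation e := (vbasis {:L}).
Local Notation T := (tensor iota L).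

HB.instance Definition _ := Vector.copy T 'rV[Knr]_n.

Definition tens (a : Knr) (l : L) : T := \row_i (a * iota (coord e i l)).

Definition tensor_lift (Z : zmodType) (f : Knr -> L -> Z) (x : T) : Z :=
  \sum_(i < n) f ((x : 'rV_n) 0 i) e`_i.

Definition balanced (Z : zmodType) (f : Knr -> L -> Z) :=
  [/\ forall a b l, f (a + b) l = f a l + f b l,
      forall a l m, f a (l + m) = f a l + f a m
    & forall a k l, f (iota k * a) l = f a (k *: l)].

Lemma tens_balanced : balanced tens.
Proof.
split=> *; apply/rowP=> i; rewrite !mxE.
- by rewrite mulrDl.
- by rewrite linearD rmorphD mulrDr.
- by rewrite linearZ rmorphM /= mulrA (mulrC (iota _)).
Qed.

Lemma tensor_basis (x : T) : x = tensor_lift tens x.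
Proof.
apply/rowP=> j; rewrite /tensor_lift summxE (bigD1 j) //= big1 ?addr0.
  by rewrite mxE coord_free ?(basis_free (vbasisP _)) // eqxx rmorph1 mulr1.
move=> i ij; rewrite mxE coord_free ?(basis_free (vbasisP _)) //.
by rewrite (negPf ij) rmorph0 mulr0.
Qed.

Lemma balanced_sumr (Z : zmodType) (f : Knr -> L -> Z) : balanced f ->
  forall a (I : finType) (g : I -> L), f a (\sum_i g i) = \sum_i f a (g i).
Proof.
case=> _ fD _ a I g.
have f0 : f a 0 = 0 by apply: (addIr (f a 0)); rewrite -fD !add0r.
by elim/big_rec2: _ => // i u v _ <-; rewrite fD.
Qed.

Lemma balanced0l (Z : zmodType) (f : Knr -> L -> Z) l : balanced f -> f 0 l = 0.
Proof.
by case=> fD _ _; apply: (addIr (f 0 l)); rewrite -fD !add0r.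
Qed.

Lemma tensor_lift_tens (Z : zmodType) (f : Knr -> L -> Z) : balanced f ->
  forall a l, tensor_lift f (tens a l) = f a l.
Proof.
move=> fB a l; have [_ _ fZ] := fB.
rewrite {2}(coord_vbasis (memvf l)) (balanced_sumr fB).
by apply: eq_bigr => i _; rewrite mxE mulrC fZ.
Qed.

Lemma tensor_lift_is_additive (Z : zmodType) (f : Knr -> L -> Z) : balanced f ->
  forall x y, tensor_lift f (x + y) = tensor_lift f x + tensor_lift f y.
Proof.
case=> fD _ _ x y; rewrite -big_split /=.
by apply: eq_bigr => i _; rewrite mxE fD.
Qed.

Lemma additive_ext (Z : zmodType) (g h : T -> Z) :
  {morph g : x y / x + y} -> {morph h : x y / x + y} ->
  (forall a l, g (tens a l) = h (tens a l)) -> g =1 h.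
Proof.
have add0 (k : T -> Z) : {morph k : x y / x + y} -> k 0 = 0.
  by move=> kD; apply: (addIr (k 0)); rewrite -kD !add0r.
move=> gD hD gh x; rewrite (tensor_basis x) /tensor_lift.
rewrite (big_morph g gD (add0 g gD)) (big_morph h hD (add0 h hD)).
exact: eq_bigr.
Qed.

Lemma tensor_universal (Z : zmodType) (f : Knr -> L -> Z) : balanced f ->
  exists! h : T -> Z,
    {morph h : x y / x + y} /\ forall a l, h (tens a l) = f a l.
Proof.
move=> fB; exists (tensor_lift f); split.
  by split; [exact: tensor_lift_is_additive | exact: tensor_lift_tens].
move=> h [hD hf]; apply/funext; apply: additive_ext => // [x y|a l].
  exact: tensor_lift_is_additive.
by rewrite hf tensor_lift_tens.
Qed.

Definition tensor_mul (x y : T) : T :=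
  tensor_lift (fun a l => tensor_lift (fun b m => tens (a * b) (l * m)) y) x.

Definition tensor_one : T := tens 1 1.

Fact tensor_mul_inner_balanced a l :
  balanced (fun b m => tens (a * b) (l * m)).
Proof.
have [D1 D2 Z] := tens_balanced; split=> *.
- by rewrite mulrDr D1.
- by rewrite mulrDr D2.
- by rewrite mulrCA Z -scalerAr.
Qed.

Fact tensor_mul_outer_balanced y :
  balanced (fun a l => tensor_lift (fun b m => tens (a * b) (l * m)) y).
Proof.
have [D1 D2 Z] := tens_balanced; split=> *.
- by rewrite -big_split; apply: eq_bigr => i _; rewrite mulrDl D1.
- by rewrite -big_split; apply: eq_bigr => i _; rewrite mulrDl D2.
- by apply: eq_bigr => i _; rewrite -mulrA Z -scalerAl.
Qed.

Lemma tensor_mul_tens a l b m :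
  tensor_mul (tens a l) (tens b m) = tens (a * b) (l * m).
Proof.
rewrite /tensor_mul tensor_lift_tens; last exact: tensor_mul_outer_balanced.
by rewrite tensor_lift_tens //; apply: tensor_mul_inner_balanced.
Qed.

Fact tensor_mulDl : left_distributive tensor_mul +%R.
Proof.
by move=> x y z; apply/tensor_lift_is_additive/tensor_mul_outer_balanced.
Qed.

Fact tensor_mulDr : right_distributive tensor_mul +%R.
Proof.
move=> x y z; rewrite -big_split; apply: eq_bigr => i _.
exact/tensor_lift_is_additive/tensor_mul_inner_balanced.
Qed.

Fact tensor_mulC : commutative tensor_mul.
Proof.
move=> x y; move: x; apply: additive_ext => [x z|x z|a l].
- exact: tensor_mulDl.
- exact: tensor_mulDr.
move: y; apply: additive_ext => [x z|x z|b m].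
- exact: tensor_mulDr.
- exact: tensor_mulDl.
by rewrite !tensor_mul_tens mulrC (mulrC l).
Qed.

Fact tensor_mulA : associative tensor_mul.
Proof.
move=> x y z; move: x; apply: additive_ext => [x t|x t|a l].
- exact: tensor_mulDl.
- by rewrite !tensor_mulDl.
move: y; apply: additive_ext => [x t|x t|b m].
- by rewrite tensor_mulDl tensor_mulDr.
- by rewrite tensor_mulDr tensor_mulDl.
move: z; apply: additive_ext => [x t|x t|c p].
- by rewrite !tensor_mulDr.
- by rewrite !tensor_mulDr.
by rewrite !tensor_mul_tens !mulrA.
Qed.

Fact tensor_mul1 : left_id tensor_one tensor_mul.
Proof.
apply: additive_ext => // [x y|a l]; first exact: tensor_mulDr.
by rewrite tensor_mul_tens !mul1r.
Qed.

Lemma tens1_inj : injective (tens 1).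
Proof.
move=> l m /rowP lm; rewrite (coord_vbasis (memvf l)) (coord_vbasis (memvf m)).
apply: eq_bigr => i _; congr (_ *: _).
by have := lm i; rewrite !mxE !mul1r => /fmorph_inj.
Qed.

Fact tensor_one_neq0 : tensor_one != 0.
Proof.
have [_ D _] := tens_balanced.
have <- : tens 1 0 = 0 by apply: (addIr (tens 1 0)); rewrite -D !add0r.
by rewrite (inj_eq tens1_inj) oner_eq0.
Qed.

HB.instance Definition _ := GRing.Zmodule_isComNzRing.Build T
  tensor_mulA tensor_mulC tensor_mul1 tensor_mulDl tensor_one_neq0.

Lemma scale_tens (c a : Knr) l : c *: tens a l = tens (c * a) l.
Proof. by apply/rowP=> i; rewrite !mxE mulrA. Qed.

Fact tensor_scaleAl (c : Knr) (x y : T) : c *: (x * y) = (c *: x) * y.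
Proof.
move: x; apply: additive_ext => [x z|x z|a l].
- by rewrite mulrDl scalerDr.
- by rewrite scalerDr mulrDl.
move: y; apply: additive_ext => [x z|x z|b m].
- by rewrite mulrDr scalerDr.
- by rewrite mulrDr.
by rewrite scale_tens /GRing.mul /= !tensor_mul_tens scale_tens mulrA.
Qed.

HB.instance Definition _ := GRing.Lmodule_isLalgebra.Build Knr T tensor_scaleAl.
HB.instance Definition _ := GRing.Lalgebra_isComAlgebra.Build Knr T.
HB.instance Definition _ := Algebra_isFalgebra.Build Knr T.

Lemma tensM a l b m : tens a l * tens b m = tens (a * b) (l * m) :> T.
Proof. exact: tensor_mul_tens. Qed.

End Tensor.

(* Gal(L/K) with the product for which it acts on the left, (s * t)%g l =
   s (t l); the product of [gal_of {:L}] is the opposite one. *)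
Definition galois_group (K : fieldType) (L : splittingFieldType K) : Type :=
  gal_of {:L}.

Section GaloisGroup.
Variables (K : fieldType) (L : splittingFieldType K).
Local Notation G := (galois_group L).

HB.instance Definition _ := Finite.copy G (gal_of {:L}).

Definition gal_app (s : G) : 'AEnd(L) := gal_repr (s : gal_of {:L}).
Coercion gal_app : galois_group >-> ahom.

Definition galois_mul (s t : G) : G := ((t : gal_of {:L}) * s)%g.
Definition galois_one : G := (1 : gal_of {:L})%g.
Definition galois_inv (s : G) : G := ((s : gal_of {:L})^-1)%g.

Fact galois_mulA : associative galois_mul.
Proof. by move=> s t u; rewrite /galois_mul mulgA. Qed.
Fact galois_mul1g : left_id galois_one galois_mul.
Proof. by move=> s; apply: mulg1. Qed.
Fact galois_mulg1 : right_id galois_one galois_mul.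
Proof. by move=> s; apply: mul1g. Qed.
Fact galois_mulVg : left_inverse galois_one galois_inv galois_mul.
Proof. by move=> s; apply: mulgV. Qed.
Fact galois_mulgV : right_inverse galois_one galois_inv galois_mul.
Proof. by move=> s; apply: mulVg. Qed.

HB.instance Definition _ := isGroup.Build G
  galois_mulA galois_mul1g galois_mulg1 galois_mulVg galois_mulgV.

Lemma galois_mulE (s t : G) (l : L) : (s * t)%g l = s (t l).
Proof. exact: (galM _ _ (memvf l)). Qed.

Lemma galois_oneE (l : L) : (1%g : G) l = l.
Proof. exact: gal_id. Qed.

Lemma galois_eqP (s t : G) : (forall l : L, s l = t l) -> s = t.
Proof.
by move=> st; apply/eqP; apply/(@gal_eqP _ _ {:L}%AS s t) => l _; apply: st.
Qed.

End GaloisGroup.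

Section Actions.
Variables (K Knr : fieldType) (iota : {rmorphism K -> Knr}).

Section Frob.
Variables (w : discrete_valuation Knr) (q : nat) (sigma : frobenius w iota q).
Variable L : fieldExtType K.
Local Notation T := (tensor iota L).

Lemma frob_iota a : sigma (iota a) = iota a.
Proof. by apply/frob_fixed; exists a. Qed.

(* sigma (x) id_L *)
Definition frobT (x : T) : T :=
  tensor_lift (fun a (l : L) => tens iota (sigma a) l) x.

Fact frobT_balanced : balanced iota (fun a (l : L) => tens iota (sigma a) l).
Proof.
have [D1 D2 Z] := tens_balanced iota L; split=> *.
- by rewrite rmorphD D1.
- by rewrite D2.
- by rewrite rmorphM frob_iota Z.
Qed.

Lemma frobT_tens a l : frobT (tens iota a l) = tens iota (sigma a) l.
Proof. exact/tensor_lift_tens/frobT_balanced. Qed.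

Fact frobTD : {morph frobT : x y / x + y}.
Proof. exact/tensor_lift_is_additive/frobT_balanced. Qed.

Fact frobT_zmod : zmod_morphism frobT.
Proof.
have f0 : frobT 0 = 0 by apply: (addIr (frobT 0)); rewrite -frobTD !add0r.
by move=> x y; apply: (addIr (frobT y)); rewrite -frobTD !subrK.
Qed.

Fact frobT_monoid : monoid_morphism frobT.
Proof.
split=> [|x y]; first by rewrite frobT_tens rmorph1.
move: x; apply: additive_ext => [x z|x z|a l].
- by rewrite mulrDl frobTD.
- by rewrite frobTD mulrDl.
move: y; apply: additive_ext => [x z|x z|b m].
- by rewrite mulrDr frobTD.
- by rewrite frobTD mulrDr.
by rewrite tensM !frobT_tens tensM rmorphM.
Qed.

HB.instance Definition _ := GRing.isZmodMorphism.Build T T frobT frobT_zmod.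
HB.instance Definition _ := GRing.isMonoidMorphism.Build T T frobT frobT_monoid.

Lemma frobTZ c x : frobT (c *: x) = sigma c *: frobT x.
Proof.
move: x; apply: additive_ext => [x y|x y|a l].
- by rewrite scalerDr raddfD.
- by rewrite raddfD scalerDr.
by rewrite scale_tens !frobT_tens scale_tens rmorphM.
Qed.

Lemma frobT_bij : bijective frobT.
Proof.
have [sigma' sK Ks] := frob_bij sigma.
have s'D a b : sigma' (a + b) = sigma' a + sigma' b.
  by apply: (bij_inj (frob_bij sigma)); rewrite rmorphD !Ks.
have s'i k a : sigma' (iota k * a) = iota k * sigma' a.
  by apply: (bij_inj (frob_bij sigma)); rewrite rmorphM !Ks frob_iota.
pose f a (l : L) := tens iota (sigma' a) l.
have fB : balanced iota f.
  have [D1 D2 Z] := tens_balanced iota L; rewrite /f; split=> *.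
  - by rewrite s'D D1.
  - by rewrite D2.
  - by rewrite s'i Z.
exists (tensor_lift f).
  apply: additive_ext => // [x y|a l].
  - by rewrite raddfD tensor_lift_is_additive.
  - by rewrite frobT_tens tensor_lift_tens // /f sK.
apply: additive_ext => // [x y|a l].
- by rewrite tensor_lift_is_additive // raddfD.
- by rewrite tensor_lift_tens // frobT_tens Ks.
Qed.

End Frob.

Section Gal.
Variable L : splittingFieldType K.
Local Notation T := (tensor iota L).
Local Notation G := (galois_group L).

(* id (x) s *)
Definition galT (s : G) (x : T) : T :=
  tensor_lift (fun a (l : L) => tens iota a (s l)) x.

Fact galT_balanced s : balanced iota (fun a (l : L) => tens iota a ((s : G) l)).
Proof.
have [D1 D2 Z] := tens_balanced iota L; split=> *.
- by rewrite D1.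
- by rewrite raddfD D2.
- by rewrite linearZ Z.
Qed.

Lemma galT_tens s a l : galT s (tens iota a l) = tens iota a (s l).
Proof. exact/tensor_lift_tens/galT_balanced. Qed.

Fact galTD s : {morph galT s : x y / x + y}.
Proof. exact/tensor_lift_is_additive/galT_balanced. Qed.

Fact galT_zmod s : zmod_morphism (galT s).
Proof.
have f0 : galT s 0 = 0 by apply: (addIr (galT s 0)); rewrite -galTD !add0r.
by move=> x y; apply: (addIr (galT s y)); rewrite -galTD !subrK.
Qed.

Fact galT_monoid s : monoid_morphism (galT s).
Proof.
split=> [|x y]; first by rewrite galT_tens rmorph1.
move: x; apply: additive_ext => [x z|x z|a l].
- by rewrite mulrDl galTD.
- by rewrite galTD mulrDl.
move: y; apply: additive_ext => [x z|x z|b m].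
- by rewrite mulrDr galTD.
- by rewrite galTD mulrDr.
by rewrite tensM !galT_tens tensM rmorphM.
Qed.

HB.instance Definition _ s :=
  GRing.isZmodMorphism.Build T T (galT s) (galT_zmod s).
HB.instance Definition _ s :=
  GRing.isMonoidMorphism.Build T T (galT s) (galT_monoid s).

Lemma galTM s t x : galT (s * t)%g x = galT s (galT t x).
Proof.
move: x; apply: additive_ext => [x y|x y|a l]; rewrite ?raddfD //.
by rewrite !galT_tens galois_mulE.
Qed.

Lemma galT1 x : galT 1%g x = x.
Proof.
move: x; apply: additive_ext => // [x y|a l]; rewrite ?raddfD //.
by rewrite galT_tens galois_oneE.
Qed.

Lemma frobT_galT w q (sigma : frobenius w iota q) s x :
  frobT sigma (galT s x) = galT s (frobT sigma x).
Proof.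
move: x; apply: additive_ext => [x y|x y|a l]; rewrite ?raddfD //.
by rewrite !(frobT_tens, galT_tens).
Qed.

End Gal.
End Actions.

Record isocrystal (Knr : fieldType) (sigma : {rmorphism Knr -> Knr}) :=
  Isocrystal {
  iso_space :> vectType Knr;
  iso_F : iso_space -> iso_space;
  iso_FD : {morph iso_F : x y / x + y};
  iso_FZ : forall a x, iso_F (a *: x) = sigma a *: iso_F x;
  iso_F_bij : bijective iso_F }.

Record iso_hom (Knr : fieldType) (sigma : {rmorphism Knr -> Knr})
    (V V' : isocrystal sigma) := IsoHom {
  iso_lfun :> 'Hom(V, V');
  iso_homP : `[< forall x, iso_lfun (iso_F x) = iso_F (iso_lfun x) >] }.

HB.instance Definition _ Knr sigma V V' :=
  [isSub for @iso_lfun Knr sigma V V'].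
HB.instance Definition _ Knr sigma V V' :=
  [Choice of @iso_hom Knr sigma V V' by <:].

(* The library's [{unit R}] is restricted to finite rings. *)
Record units (R : unitRingType) := Units {
  unit_val : R;
  unit_valP : unit_val \is a GRing.unit }.

HB.instance Definition _ R := [isSub for @unit_val R].
HB.instance Definition _ R := [Choice of @units R by <:].

Section Units.
Variable R : unitRingType.
Implicit Types u v : units R.

Definition units_one : units R := Units (unitr1 R).
Fact units_mul_subproof u v : unit_val u * unit_val v \is a GRing.unit.
Proof. by rewrite unitrMl ?unit_valP. Qed.
Definition units_mul u v := Units (units_mul_subproof u v).
Fact units_inv_subproof u : (unit_val u)^-1 \is a GRing.unit.
Proof. by rewrite unitrV unit_valP. Qed.
Definition units_inv u := Units (units_inv_subproof u).

Fact units_mulA : associative units_mul.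
Proof. by move=> u v w; apply: val_inj; rewrite /= mulrA. Qed.
Fact units_mul1g : left_id units_one units_mul.
Proof. by move=> u; apply: val_inj; rewrite /= mul1r. Qed.
Fact units_mulg1 : right_id units_one units_mul.
Proof. by move=> u; apply: val_inj; rewrite /= mulr1. Qed.
Fact units_mulVg : left_inverse units_one units_inv units_mul.
Proof. by move=> u; apply: val_inj; rewrite /= mulVr ?unit_valP. Qed.
Fact units_mulgV : right_inverse units_one units_inv units_mul.
Proof. by move=> u; apply: val_inj; rewrite /= divrr ?unit_valP. Qed.

HB.instance Definition _ := isGroup.Build (units R)
  units_mulA units_mul1g units_mulg1 units_mulVg units_mulgV.

End Units.

Section EndoAlgebra.
Variables (K Knr : fieldType) (iota : {rmorphism K -> Knr}).
Variables (w : discrete_valuation Knr) (q : nat) (sigma : frobenius w iota q).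
Variable L : fieldExtType K.
Local Notation T := (tensor iota L).
Variable alpha : units T.

Definition LK_F (x : T) : T := unit_val alpha * frobT sigma x.

Fact LK_FD : {morph LK_F : x y / x + y}.
Proof. by move=> x y; rewrite /LK_F raddfD mulrDr. Qed.
Fact LK_FZ a x : LK_F (a *: x) = sigma a *: LK_F x.
Proof. by rewrite /LK_F frobTZ scalerAr. Qed.
Fact LK_F_bij : bijective LK_F.
Proof.
have [f' fK Kf] := frobT_bij sigma L.
have Ua := unit_valP alpha.
exists (fun x : T => f' ((unit_val alpha)^-1 * x)) => x; rewrite /LK_F.
  by rewrite mulKr ?fK.
by rewrite Kf mulVKr.
Qed.

Definition LK_isocrystal : isocrystal sigma :=
  Isocrystal (iso_space := T) LK_FD LK_FZ LK_F_bij.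

Definition DK : Type := iso_hom LK_isocrystal LK_isocrystal.

HB.instance Definition _ := SubChoice.on DK.

Definition DK_fun (f : DK) (x : T) : T := iso_lfun f x.
Coercion DK_fun : DK >-> Funclass.

Lemma DK_F (f : DK) (x : T) : f (LK_F x) = LK_F (f x).
Proof. exact: (asboolW (iso_homP f)). Qed.

Lemma DK_ext (f g : DK) : (forall x : T, f x = g x) -> f = g.
Proof. by move=> fg; apply: val_inj; apply/lfunP => x; apply: fg. Qed.

Definition DK_of (f : 'End(T)) (fF : forall x, f (LK_F x) = LK_F (f x)) : DK :=
  @IsoHom _ _ LK_isocrystal LK_isocrystal f (asboolT fF).

Fact DK_zero_subproof x : (0 : 'End(T)) (LK_F x) = LK_F ((0 : 'End(T)) x).
Proof. by rewrite !zero_lfunE /LK_F raddf0 mulr0. Qed.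
Definition DK_zero := DK_of DK_zero_subproof.

Fact DK_opp_subproof (f : DK) x :
  (- iso_lfun f : 'End(T)) (LK_F x) = LK_F ((- iso_lfun f : 'End(T)) x).
Proof. by rewrite !opp_lfunE -/(DK_fun _ _) DK_F /LK_F raddfN mulrN. Qed.
Definition DK_opp f := DK_of (DK_opp_subproof f).

Fact DK_add_subproof (f g : DK) x :
  (iso_lfun f + iso_lfun g : 'End(T)) (LK_F x) =
  LK_F ((iso_lfun f + iso_lfun g : 'End(T)) x).
Proof. by rewrite !add_lfunE LK_FD -!/(DK_fun _ _) !DK_F. Qed.
Definition DK_add f g := DK_of (DK_add_subproof f g).

Fact DK_one_subproof x : (\1%VF : 'End(T)) (LK_F x) = LK_F ((\1%VF : 'End(T)) x).
Proof. by rewrite !id_lfunE. Qed.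
Definition DK_one := DK_of DK_one_subproof.

Fact DK_mul_subproof (f g : DK) x :
  (iso_lfun f \o iso_lfun g : 'End(T))%VF (LK_F x) =
  LK_F ((iso_lfun f \o iso_lfun g : 'End(T))%VF x).
Proof. by rewrite !comp_lfunE -!/(DK_fun _ _) !DK_F. Qed.
Definition DK_mul f g := DK_of (DK_mul_subproof f g).

Fact DK_scale_subproof (k : K) (f : DK) x :
  (iota k *: iso_lfun f : 'End(T)) (LK_F x) =
  LK_F ((iota k *: iso_lfun f : 'End(T)) x).
Proof.
by rewrite !scale_lfunE -!/(DK_fun _ _) DK_F LK_FZ frob_iota.
Qed.
Definition DK_scale k f := DK_of (DK_scale_subproof k f).

Fact DK_addA : associative DK_add.
Proof. by move=> f g h; apply: val_inj; apply: addrA. Qed.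
Fact DK_addC : commutative DK_add.
Proof. by move=> f g; apply: val_inj; apply: addrC. Qed.
Fact DK_add0 : left_id DK_zero DK_add.
Proof. by move=> f; apply: val_inj; apply: add0r. Qed.
Fact DK_addN : left_inverse DK_zero DK_opp DK_add.
Proof. by move=> f; apply: val_inj; apply: addNr. Qed.

HB.instance Definition _ := GRing.isZmodule.Build DK
  DK_addA DK_addC DK_add0 DK_addN.

Fact DK_mulA : associative DK_mul.
Proof. by move=> f g h; apply: val_inj; apply: comp_lfunA. Qed.
Fact DK_mul1 : left_id DK_one DK_mul.
Proof. by move=> f; apply: val_inj; apply: comp_lfun1l. Qed.
Fact DK_mulr1 : right_id DK_one DK_mul.
Proof. by move=> f; apply: val_inj; apply: comp_lfun1r. Qed.
Fact DK_mulDl : left_distributive DK_mul DK_add.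
Proof. by move=> f g h; apply: val_inj; apply: comp_lfunDl. Qed.
Fact DK_mulDr : right_distributive DK_mul DK_add.
Proof. by move=> f g h; apply: val_inj; apply: comp_lfunDr. Qed.
Fact DK_one_neq0 : DK_one != 0.
Proof.
apply/eqP=> /(congr1 (fun f : DK => f 1)).
by rewrite /DK_fun id_lfunE zero_lfunE => /eqP; rewrite oner_eq0.
Qed.

HB.instance Definition _ := GRing.Zmodule_isNzRing.Build DK
  DK_mulA DK_mul1 DK_mulr1 DK_mulDl DK_mulDr DK_one_neq0.

Fact DK_scaleA a b f : DK_scale a (DK_scale b f) = DK_scale (a * b) f.
Proof. by apply: val_inj; rewrite /= rmorphM scalerA. Qed.
Fact DK_scale1 : left_id 1 DK_scale.
Proof. by move=> f; apply: val_inj; rewrite /= rmorph1 scale1r. Qed.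
Fact DK_scaleDr : right_distributive DK_scale +%R.
Proof. by move=> a f g; apply: val_inj; apply: scalerDr. Qed.
Fact DK_scaleDl f : {morph DK_scale^~ f : a b / a + b}.
Proof. by move=> a b; apply: val_inj; rewrite /= rmorphD scalerDl. Qed.

HB.instance Definition _ := GRing.Zmodule_isLmodule.Build K DK
  DK_scaleA DK_scale1 DK_scaleDr DK_scaleDl.

Fact DK_scaleAl (a : K) (f g : DK) : a *: (f * g) = (a *: f) * g.
Proof. by apply: val_inj; apply: comp_lfunZl. Qed.
HB.instance Definition _ := GRing.Lmodule_isLalgebra.Build K DK DK_scaleAl.
Fact DK_scaleAr (a : K) (f g : DK) : a *: (f * g) = f * (a *: g).
Proof. by apply: val_inj; apply: comp_lfunZr. Qed.
HB.instance Definition _ := GRing.Lalgebra_isAlgebra.Build K DK DK_scaleAr.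

Definition DK_unit : pred DK := fun f => lker (iso_lfun f) == 0%VS.

Fact DK_inv_subproof (f : DK) : DK_unit f ->
  forall x, ((iso_lfun f)^-1)%VF (LK_F x) = LK_F (((iso_lfun f)^-1)%VF x).
Proof.
move=> f0 x; have fI : injective (iso_lfun f) by apply/lker0P.
by apply: fI; rewrite -[RHS]/(f _) DK_F /DK_fun !(lker0_lfunVK f0).
Qed.

Definition DK_inv (f : DK) : DK :=
  if boolP (DK_unit f) is AltTrue f0 then DK_of (DK_inv_subproof f0) else f.

Fact DK_mulVr : {in DK_unit, left_inverse 1 DK_inv *%R}.
Proof.
move=> f Uf; rewrite /DK_inv; case: {-}_ / boolP => [f0|/negP//].
by apply: val_inj; apply: lker0_compVf.
Qed.
Fact DK_mulrV : {in DK_unit, right_inverse 1 DK_inv *%R}.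
Proof.
move=> f Uf; rewrite /DK_inv; case: {-}_ / boolP => [f0|/negP//].
by apply: val_inj; apply: lker0_compfV.
Qed.
Fact DK_unitP (f g : DK) : g * f = 1 /\ f * g = 1 -> DK_unit f.
Proof.
case=> gf _; apply/lker0P; apply: (can_inj (g := iso_lfun g)) => x.
have /(congr1 (fun h : DK => h x)) := gf.
by rewrite /DK_fun /= comp_lfunE id_lfunE.
Qed.
Fact DK_inv_out : {in [predC DK_unit], DK_inv =1 id}.
Proof.
by move=> f /negP Uf; rewrite /DK_inv; case: {-}_ / boolP.
Qed.

HB.instance Definition _ := GRing.NzRing_hasMulInverse.Build DK
  DK_mulVr DK_mulrV DK_unitP DK_inv_out.

Fact DK_emb_subproof (l : L) x :
  amull (tens iota 1 l : T) (LK_F x) = LK_F (amull (tens iota 1 l : T) x).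
Proof.
rewrite !lfunE /= /LK_F (rmorphM (frobT sigma (L:=L))) /= frobT_tens rmorph1.
exact: mulrCA.
Qed.
Definition DK_emb (l : L) : DK := DK_of (DK_emb_subproof l).

Lemma DK_embE l x : DK_emb l x = tens iota 1 l * x.
Proof. by rewrite /DK_fun lfunE. Qed.

Lemma DK_emb_inj : injective DK_emb.
Proof.
move=> l m /(congr1 (fun f : DK => f 1)); rewrite !DK_embE !mulr1.
exact: tens1_inj.
Qed.

Lemma DK_embM l m : DK_emb (l * m) = DK_emb l * DK_emb m.
Proof.
apply: DK_ext => x; rewrite /DK_fun [in RHS]comp_lfunE -!/(DK_fun _ _) !DK_embE.
by rewrite mulrA tensM mulr1.
Qed.

Lemma DK_emb1 : DK_emb 1 = 1.
Proof. by apply: DK_ext => x; rewrite DK_embE mul1r /DK_fun id_lfunE. Qed.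

Lemma DK_emb_unit (l : units L) : DK_emb (unit_val l) \is a GRing.unit.
Proof.
apply/unitrP; exists (DK_emb (unit_val l)^-1).
by rewrite -!DK_embM mulVr ?divrr ?unit_valP ?DK_emb1.
Qed.

End EndoAlgebra.

Definition group_extension (A E G : groupType) (i : A -> E) (p : E -> G) :=
  [/\ {morph i : x y / (x * y)%g}, {morph p : x y / (x * y)%g}, injective i,
      forall x, p x = 1%g <-> exists a, x = i a
    & forall g, exists x, p x = g].

Definition extension_isom (A E E' G : groupType) (i : A -> E) (p : E -> G)
    (i' : A -> E') (p' : E' -> G) :=
  exists theta : E -> E',
    [/\ {morph theta : x y / (x * y)%g}, bijective theta,
        forall a, theta (i a) = i' a & forall x, p' (theta x) = p x].

Section Extensions.
Variables (K Knr : fieldType) (iota : {rmorphism K -> Knr}).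
Variables (w : discrete_valuation Knr) (q : nat) (sigma : frobenius w iota q).
Variable L : splittingFieldType K.
Local Notation T := (tensor iota L).
Local Notation G := (galois_group L).
Variable alpha : units T.
Local Notation D := (DK sigma alpha).
Local Notation a := (unit_val alpha).

Lemma galT_unit s (x : T) : x \is a GRing.unit -> galT s x \is a GRing.unit.
Proof. exact: rmorph_unit. Qed.

Definition W_cond (x : units T * G) :=
  frobT sigma (unit_val x.1) / unit_val x.1 == galT x.2 a / a.

Record W := MkW { W_pair :> units T * G; W_condP : W_cond W_pair }.

HB.instance Definition _ := [isSub for W_pair].
HB.instance Definition _ := [Choice of W by <:].

Lemma W_condE x :
  W_cond x = (frobT sigma (unit_val x.1) * a == galT x.2 a * unit_val x.1).
Proof.
have [Ua Ux] := (unit_valP alpha, unit_valP x.1).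
rewrite /W_cond; apply/eqP/eqP => [E|E].
  by rewrite -[in LHS](divrK Ux (frobT _ _)) E mulrAC divrK.
apply: (mulIr Ux); rewrite divrK // mulrAC; apply: (mulIr Ua).
by rewrite divrK.
Qed.

Definition galU s (x : units T) : units T := Units (galT_unit s (unit_valP x)).

Fact W_mul_subproof (x y : W) :
  W_cond ((W_pair x).1 * galU (W_pair x).2 (W_pair y).1,
          (W_pair x).2 * (W_pair y).2)%g.
Proof.
case: x y => [[b s] /= +] [[c t] /= +]; rewrite !W_condE /= => /eqP E1 /eqP E2.
rewrite !rmorphM /= frobT_galT galTM; apply/eqP.
have Ua : galT s a \is a GRing.unit by apply/galT_unit/unit_valP.
have := congr1 (galT s) E2; rewrite !rmorphM /= => E3.
set f := frobT _ _; set g := galT s (frobT _ _); rewrite -/f -/g in E1 E3 *.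
apply: (mulIr Ua); rewrite (mulrAC f) -[LHS]mulrA E1 E3 [RHS]mulrC -!mulrA.
by rewrite [in LHS](mulrCA (unit_val b)).
Qed.
Definition W_mul x y := MkW (W_mul_subproof x y).

Fact W_one_subproof : W_cond 1%g.
Proof. by rewrite W_condE /= rmorph1 galT1 mul1r mulr1. Qed.
Definition W_one := MkW W_one_subproof.

Fact W_inv_subproof (x : W) :
  W_cond (galU (W_pair x).2^-1 (W_pair x).1^-1, (W_pair x).2^-1)%g.
Proof.
case: x => [[b s] /= +]; rewrite !W_condE /= => /eqP E.
have Ub := unit_valP b.
have Us : frobT sigma (unit_val b) \is a GRing.unit by apply: rmorph_unit.
rewrite frobT_galT -{1}[a]galT1 -(mulVg s) galTM -!rmorphM; apply/eqP.
congr (galT _ _); rewrite rmorphV //; apply: (mulrI Us); rewrite mulVKr //.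
by apply: (mulIr Ub); rewrite -E -!mulrA mulVr ?mulr1.
Qed.
Definition W_inv x := MkW (W_inv_subproof x).

Fact W_mulA : associative W_mul.
Proof.
move=> x y z; apply: val_inj => /=; congr (_, _); last exact: mulgA.
by apply: val_inj; rewrite /= rmorphM galTM mulrA.
Qed.
Fact W_mul1g : left_id W_one W_mul.
Proof.
case=> [[b s] ?]; apply: val_inj => /=; congr (_, _); last exact: mul1g.
by apply: val_inj; rewrite /= galT1 mul1r.
Qed.
Fact W_mulg1 : right_id W_one W_mul.
Proof.
case=> [[b s] ?]; apply: val_inj => /=; congr (_, _); last exact: mulg1.
by apply: val_inj; rewrite /= rmorph1 mulr1.
Qed.
Fact W_mulVg : left_inverse W_one W_inv W_mul.
Proof.
case=> [[b s] ?]; apply: val_inj => /=; congr (_, _); last exact: mulVg.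
by apply: val_inj; rewrite /= -rmorphM mulVr ?unit_valP ?rmorph1.
Qed.
Fact W_mulgV : right_inverse W_one W_inv W_mul.
Proof.
case=> [[b s] ?]; apply: val_inj => /=; congr (_, _); last exact: mulgV.
by apply: val_inj; rewrite /= -galTM mulgV galT1 divrr ?unit_valP.
Qed.

HB.instance Definition _ :=
  isGroup.Build W W_mulA W_mul1g W_mulg1 W_mulVg W_mulgV.

Fact W_incl_unit (l : units L) : tens iota 1 (unit_val l) \is a GRing.unit.
Proof.
apply/unitrP; exists (tens iota 1 (unit_val l)^-1).
by rewrite !tensM mulVr ?divrr ?unit_valP ?mulr1.
Qed.
Fact W_incl_subproof (l : units L) : W_cond (Units (W_incl_unit l), 1%g).
Proof. by rewrite W_condE /= galT1 frobT_tens rmorph1 mulrC. Qed.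

Definition W_incl (l : units L) : W := MkW (W_incl_subproof l).
Definition W_proj (x : W) : G := (W_pair x).2.

Definition induces (u : units D) (s : G) :=
  forall l : L, unit_val u * DK_emb sigma alpha l / unit_val u =
                DK_emb sigma alpha (s l).

(* The subgroup of D_K(alpha)^x underlying the extension attached to it. *)
Record DKgrp := MkDKgrp {
  DKgrp_unit :> units D;
  DKgrp_cond : `[< exists s, induces DKgrp_unit s >] }.

HB.instance Definition _ := [isSub for DKgrp_unit].
HB.instance Definition _ := [Choice of DKgrp by <:].

Lemma inducesM u v s t :
  induces u s -> induces v t -> induces (u * v)%g (s * t)%g.
Proof.
move=> us vt l /=; rewrite invrM ?unit_valP // galois_mulE -us -vt.
by rewrite !mulrA.
Qed.

Lemma induces1 : induces 1%g 1%g.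
Proof. by move=> l; rewrite /= mul1r divr1 galois_oneE. Qed.

Lemma inducesV u s : induces u s -> induces u^-1%g s^-1%g.
Proof.
move=> us l /=; rewrite -{1}[l]galois_oneE -(mulgV s) galois_mulE -us invrK.
by rewrite !mulrA mulVr ?unit_valP // mul1r divrK ?unit_valP.
Qed.

Lemma induces_inj u s t : induces u s -> induces u t -> s = t.
Proof.
move=> us ut; apply: galois_eqP => l.
by apply: (@DK_emb_inj _ _ _ _ _ sigma L alpha); rewrite -us -ut.
Qed.

Fact DKgrp_mul_subproof (u v : DKgrp) :
  `[< exists s, induces (DKgrp_unit u * DKgrp_unit v)%g s >].
Proof.
apply: asboolT; have [s us] := asboolW (DKgrp_cond u).
by have [t vt] := asboolW (DKgrp_cond v); exists (s * t)%g; apply: inducesM.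
Qed.
Definition DKgrp_mul u v := MkDKgrp (DKgrp_mul_subproof u v).

Fact DKgrp_one_subproof : `[< exists s, induces 1%g s >].
Proof. by apply: asboolT; exists 1%g; apply: induces1. Qed.
Definition DKgrp_one := MkDKgrp DKgrp_one_subproof.

Fact DKgrp_inv_subproof (u : DKgrp) : `[< exists s, induces (DKgrp_unit u)^-1%g s >].
Proof.
apply: asboolT; have [s us] := asboolW (DKgrp_cond u).
by exists s^-1%g; apply: inducesV.
Qed.
Definition DKgrp_inv u := MkDKgrp (DKgrp_inv_subproof u).

Fact DKgrp_mulA : associative DKgrp_mul.
Proof. by move=> u v x; apply: val_inj; apply: mulgA. Qed.
Fact DKgrp_mul1g : left_id DKgrp_one DKgrp_mul.
Proof. by move=> u; apply: val_inj; apply: mul1g. Qed.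
Fact DKgrp_mulg1 : right_id DKgrp_one DKgrp_mul.
Proof. by move=> u; apply: val_inj; apply: mulg1. Qed.
Fact DKgrp_mulVg : left_inverse DKgrp_one DKgrp_inv DKgrp_mul.
Proof. by move=> u; apply: val_inj; apply: mulVg. Qed.
Fact DKgrp_mulgV : right_inverse DKgrp_one DKgrp_inv DKgrp_mul.
Proof. by move=> u; apply: val_inj; apply: mulgV. Qed.

HB.instance Definition _ :=
  isGroup.Build DKgrp DKgrp_mulA DKgrp_mul1g DKgrp_mulg1 DKgrp_mulVg DKgrp_mulgV.

Fact DKgrp_incl_subproof (l : units L) :
  `[< exists s, induces (Units (DK_emb_unit sigma alpha l)) s >].
Proof.
apply: asboolT; exists 1%g => m /=; rewrite galois_oneE -DK_embM mulrC DK_embM.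
by rewrite mulrK ?DK_emb_unit.
Qed.
Definition DKgrp_incl (l : units L) : DKgrp := MkDKgrp (DKgrp_incl_subproof l).

Definition DKgrp_proj (u : DKgrp) : G := projT1 (cid (asboolW (DKgrp_cond u))).

(* By [induces_inj] this determines DKgrp_proj u. *)
Lemma DKgrp_projP (u : DKgrp) : induces (DKgrp_unit u) (DKgrp_proj u).
Proof. exact: (projT2 (cid (asboolW (DKgrp_cond u)))). Qed.

End Extensions.

Arguments W_proj {K Knr iota w q} sigma {L} alpha x.
Arguments W_incl {K Knr iota w q} sigma {L} alpha l.
Arguments DKgrp_proj {K Knr iota w q} sigma {L} alpha u.
Arguments DKgrp_incl {K Knr iota w q} sigma {L} alpha l.

Record normalized_cocycle (K : fieldType) (L : splittingFieldType K) :=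
  NormalizedCocycle {
  cocyc :> galois_group L -> galois_group L -> L;
  cocyc_neq0 : forall s t, cocyc s t != 0;
  cocycE : forall s t r : galois_group L,
    s (cocyc t r) * cocyc s (t * r)%g = cocyc s t * cocyc (s * t)%g r;
  cocyc1g : forall s, cocyc 1%g s = 1;
  cocycg1 : forall s, cocyc s 1%g = 1 }.

(* The element \sum_s l_s u_s is the function s |-> l_s. *)
Definition crossed_product (K : fieldType) (L : splittingFieldType K)
    (c : normalized_cocycle L) : Type := {ffun galois_group L -> L}.

Section CrossedProduct.
Variables (K : fieldType) (L : splittingFieldType K) (c : normalized_cocycle L).
Local Notation G := (galois_group L).
Local Notation A := (crossed_product c).

HB.instance Definition _ := GRing.Lmodule.copy A {ffun G -> L}.

Definition cp_fun (x : A) : G -> L := x : {ffun G -> L}.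
Coercion cp_fun : crossed_product >-> Funclass.

(* l u_s *)
Definition cp_mon (l : L) (s : G) : A := [ffun t => if t == s then l else 0].

Lemma cp_monD s : {morph cp_mon^~ s : l m / l + m}.
Proof. by move=> l m; apply/ffunP=> t; rewrite !ffunE; case: eqP; rewrite ?addr0. Qed.

Lemma cp_mon0 s : cp_mon 0 s = 0.
Proof. by apply/ffunP=> t; rewrite !ffunE; case: eqP. Qed.

Lemma cp_sum_mon (x : A) : x = \sum_s cp_mon (x s) s.
Proof.
apply/ffunP=> t; rewrite sum_ffunE (bigD1 t) //= big1 ?addr0 ?ffunE ?eqxx //.
by move=> s st; rewrite ffunE eq_sym (negPf st).
Qed.

(* (l u_s)(m u_t) = l s(m) a_{s,t} u_{st} *)
Definition cp_mul (x y : A) : A :=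
  \sum_s \sum_t cp_mon (x s * s (y t) * c s t) (s * t)%g.

Definition cp_one : A := cp_mon 1 1%g.

Fact cp_mulDl : left_distributive cp_mul +%R.
Proof.
move=> x y z; rewrite -big_split; apply: eq_bigr => s _.
rewrite -big_split; apply: eq_bigr => t _.
by rewrite {1}/cp_fun ffunE !mulrDl cp_monD.
Qed.

Fact cp_mulDr : right_distributive cp_mul +%R.
Proof.
move=> x y z; rewrite -big_split; apply: eq_bigr => s _.
rewrite -big_split; apply: eq_bigr => t _.
by rewrite {2}/cp_fun ffunE raddfD mulrDr mulrDl cp_monD.
Qed.

Lemma cp_mul_mon l s m t :
  cp_mul (cp_mon l s) (cp_mon m t) = cp_mon (l * s m * c s t) (s * t)%g.
Proof.
rewrite /cp_mul (bigD1 s) //= [X in _ + X]big1 ?addr0 => [|s' ss]; last first.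
  by apply: big1 => t' _; rewrite {1}/cp_fun ffunE (negPf ss) !mul0r cp_mon0.
rewrite (bigD1 t) //= [X in _ + X]big1 ?addr0 => [|t' tt]; last first.
  by rewrite {2}/cp_fun ffunE (negPf tt) raddf0 mulr0 mul0r cp_mon0.
by rewrite /cp_fun !ffunE !eqxx.
Qed.

Lemma cp_ext (Z : zmodType) (f g : A -> Z) :
  {morph f : x y / x + y} -> {morph g : x y / x + y} ->
  (forall l s, f (cp_mon l s) = g (cp_mon l s)) -> f =1 g.
Proof.
have add0 (k : A -> Z) : {morph k : x y / x + y} -> k 0 = 0.
  by move=> kD; apply: (addIr (k 0)); rewrite -kD !add0r.
move=> fD gD fg x; rewrite (cp_sum_mon x).
rewrite (big_morph f fD (add0 f fD)) (big_morph g gD (add0 g gD)).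
by apply: eq_bigr => s _.
Qed.

Fact cp_mulA : associative cp_mul.
Proof.
move=> x y z; move: x; apply: cp_ext => [x t|x t|l s].
- exact: cp_mulDl.
- by rewrite !cp_mulDl.
move: y; apply: cp_ext => [x t|x t|m t].
- by rewrite cp_mulDl cp_mulDr.
- by rewrite cp_mulDr cp_mulDl.
move: z; apply: cp_ext => [x y|x y|k r].
- by rewrite !cp_mulDr.
- by rewrite !cp_mulDr.
rewrite !cp_mul_mon mulgA !rmorphM galois_mulE; congr (cp_mon _ _).
rewrite -!mulrA; congr (_ * (_ * _)).
rewrite [RHS]mulrCA; congr (_ * _); exact: cocycE.
Qed.

Fact cp_mul1 : left_id cp_one cp_mul.
Proof.
apply: cp_ext => // [x y|l s]; first exact: cp_mulDr.
by rewrite cp_mul_mon mul1g cocyc1g mul1r mulr1 galois_oneE.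
Qed.

Fact cp_mulr1 : right_id cp_one cp_mul.
Proof.
apply: cp_ext => // [x y|l s]; first exact: cp_mulDl.
by rewrite cp_mul_mon mulg1 cocycg1 rmorph1 !mulr1.
Qed.

Fact cp_one_neq0 : cp_one != 0.
Proof.
by apply/eqP=> /ffunP/(_ 1%g); rewrite !ffunE eqxx => /eqP; rewrite oner_eq0.
Qed.

HB.instance Definition _ := GRing.Zmodule_isNzRing.Build A
  cp_mulA cp_mul1 cp_mulr1 cp_mulDl cp_mulDr cp_one_neq0.

Lemma cp_scale_mon (k : K) l s : k *: cp_mon l s = cp_mon (k *: l) s.
Proof. by apply/ffunP=> t; rewrite !ffunE; case: eqP; rewrite ?scaler0. Qed.

Fact cp_scaleAl (k : K) (x y : A) : k *: (x * y) = (k *: x) * y.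
Proof.
move: x; apply: cp_ext => [x z|x z|l s].
- by rewrite mulrDl scalerDr.
- by rewrite scalerDr mulrDl.
move: y; apply: cp_ext => [x z|x z|m t].
- by rewrite mulrDr scalerDr.
- by rewrite mulrDr.
by rewrite cp_scale_mon /GRing.mul /= !cp_mul_mon cp_scale_mon !scalerAl.
Qed.
HB.instance Definition _ := GRing.Lmodule_isLalgebra.Build K A cp_scaleAl.

Fact cp_scaleAr (k : K) (x y : A) : k *: (x * y) = x * (k *: y).
Proof.
move: x; apply: cp_ext => [x z|x z|l s].
- by rewrite mulrDl scalerDr.
- by rewrite mulrDl.
move: y; apply: cp_ext => [x z|x z|m t].
- by rewrite mulrDr scalerDr.
- by rewrite scalerDr mulrDr.
rewrite cp_scale_mon /GRing.mul /= !cp_mul_mon cp_scale_mon.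
by rewrite linearZ -scalerAr -scalerAl.
Qed.
HB.instance Definition _ := GRing.Lalgebra_isAlgebra.Build K A cp_scaleAr.

End CrossedProduct.

(* Main.v *)
Require Import Defs.
From HB Require Import structures.
From mathcomp Require Import all_boot all_order all_algebra.
From mathcomp Require Import all_fingroup all_solvable all_field.
From mathcomp Require Import boolp.

Set Implicit Arguments.
Unset Strict Implicit.
Unset Printing Implicit Defensive.
Import Order.TTheory GRing.Theory Num.Theory.
Local Open Scope ring_scope.

(** Write L_K for [tensor iota L].  The group G acts on L_K through L, and the
    maps x |-> c * s(x), for c in L_K and s in G, are K^nr-linear.  Two facts
    about them carry the proof.

    Every K^nr-linear endomorphism of L_K is uniquely a sum of maps
    x |-> c_s * s(x), s in G ([twist_inj], [linear_twist]).  This is the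
    decomposition of End_K(L) as the sum of the L s, extended to K^nr: both
    halves say that the matrix of the s(e_i), for a K-basis (e_i) of L, is
    invertible; it has independent rows by Dedekind's theorem, and it is square
    because L/K is Galois.

    The map x |-> c * s(x) commutes with F_alpha exactly when
    sigma(c) alpha = s(alpha) c.  For fixed s, any two solutions c, one of them
    a unit, differ by a factor fixed by sigma, and the fixed points of sigma
    are L, as one sees on coordinates ([frobT_fixed], [frobT_coef_multiple]).

    Hence each pair (b, s) of W(alpha) gives the automorphism x |-> b * s(x)
    of the isocrystal, and composing such automorphisms follows the law of
    W(alpha).  It induces s on L; conversely an automorphism u inducing s is
    determined by u(1), because u(l) = s(l) u(1), so it is x |-> u(1) * s(x).
    This identifies the two extensions ([extension_isom_DK_W]).

    Put u_s for x |-> beta_s * s(x).  By the two facts, D_K(alpha) is the direct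
    sum of the L u_s.  Since u_s u_t and u_(st) both come from elements of
    W(alpha) above st, they differ by a factor a_(s,t) of L, the factor set of
    the section s |-> (beta_s, s); associativity in W(alpha) is the cocycle
    identity, and u_s l = s(l) u_s, so D_K(alpha) is the crossed product
    ([cocycle_of_section], [crossed_product_isom]). *)

(** * Transport of group extensions *)

Lemma group_extension_of_isom (A E E' G : groupType) (i : A -> E) (p : E -> G)
    (i' : A -> E') (p' : E' -> G) :
  extension_isom i p i' p' -> group_extension i' p' -> group_extension i p.
Proof.
case=> th [thM [th' thK th'K] thi thp] [iM pM i_inj p_ker p_onto].
have th_inj : injective th := can_inj thK.
split=> [a b|x y|a b ab|x|g].
- by apply: th_inj; rewrite thM !thi iM.
- by rewrite -!thp thM pM.
- by apply: i_inj; rewrite -!thi ab.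
- rewrite -thp p_ker; split=> -[a].
    by rewrite -thi => /th_inj ->; exists a.
  by move=> ->; exists a; rewrite thi.
- by have [x <-] := p_onto g; exists (th' x); rewrite -thp th'K.
Qed.

(** * The tensor product: fixed points of sigma and linear endomorphisms *)

Section TensorL.
Variables (K Knr : fieldType) (iota : {rmorphism K -> Knr}).

Section Field.
Variable L : fieldExtType K.
Local Notation T := (tensor iota L).

Fact tens1_zmod : zmod_morphism (tens iota 1 : L -> T).
Proof.
have [_ D _] := tens_balanced iota L; move=> l m.
by apply: (addIr (tens iota 1 m)); rewrite -D !subrK.
Qed.

Fact tens1_monoid : monoid_morphism (tens iota 1 : L -> T).
Proof. by split=> // l m; rewrite tensM mulr1. Qed.

HB.instance Definition _ :=
  GRing.isZmodMorphism.Build L T (tens iota 1) tens1_zmod.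
HB.instance Definition _ :=
  GRing.isMonoidMorphism.Build L T (tens iota 1) tens1_monoid.

Lemma tens_scale1 a (l : L) : tens iota a l = a *: tens iota 1 l.
Proof. by rewrite scale_tens mulr1. Qed.

Lemma tens1Z k (l : L) : tens iota 1 (k *: l) = iota k *: tens iota 1 l.
Proof. by have [_ _ <-] := tens_balanced iota L; rewrite tens_scale1 mulr1. Qed.

(** Since sigma fixes L, it acts on L_K coordinatewise in the basis coming from
    L, so a fixed vector has its coordinates in K. *)
Lemma frobT_fixed w q (sigma : frobenius w iota q) (x : T) :
  frobT sigma x = x -> exists l, x = tens iota 1 l.
Proof.
have -> : frobT sigma x = map_mx sigma (x : 'rV_(\dim {:L})).
  rewrite [RHS](tensor_basis (_ : T)) /frobT /tensor_lift.
  by apply: eq_bigr => i _; rewrite mxE.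
move=> /rowP xF.
have /choice[k xk] i : exists k, (x : 'rV_(\dim {:L})) 0 i = iota k.
  by apply/(frob_fixed sigma); have := xF i; rewrite mxE.
exists (\sum_i k i *: (vbasis {:L})`_i).
rewrite rmorph_sum [LHS]tensor_basis; apply: eq_bigr => i _.
by rewrite xk /= tens1Z -tens_scale1.
Qed.

End Field.

Variable L : splittingFieldType K.
Local Notation T := (tensor iota L).
Local Notation G := (galois_group L).

Lemma galTZ (s : G) c (x : T) : galT s (c *: x) = c *: galT s x.
Proof.
move: x; apply: additive_ext => [x y|x y|a l].
- by rewrite scalerDr raddfD.
- by rewrite raddfD scalerDr.
by rewrite scale_tens !galT_tens scale_tens.
Qed.

HB.instance Definition _ s :=
  GRing.isScalable.Build Knr T T *:%R (galT s) (galTZ s).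

(** The element of the twisted group ring of G over L_K with coefficients [c],
    acting on L_K. *)
Definition twist (c : G -> T) (x : T) : T := \sum_s c s * galT s x.

Definition gal_mx : 'M[L]_(#|{: G}|, \dim {:L}) :=
  \matrix_(i, j) (enum_val i : G) (vbasis {:L})`_j.

(** Dedekind's independence of automorphisms: a relation between the rows, being
    tested on a basis of L, is a relation between the automorphisms. *)
Lemma gal_mx_row_free : row_free gal_mx.
Proof.
apply/inj_row_free => u uM; apply/rowP=> i; rewrite mxE.
pose c (s : gal_of {:L}) : L := u 0 (enum_rank (s : G)).
have c0 l : l \in {:L}%VS -> \sum_(s : gal_of {:L} | true) c s * s l = 0.
  move=> _; rewrite (coord_vbasis (memvf l)).
  under eq_bigr do rewrite linear_sum mulr_sumr.
  rewrite exchange_big big1 //= => j _.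
  under eq_bigr do rewrite linearZ -scalerAr.
  rewrite -scaler_sumr; move/rowP/(_ j): uM; rewrite !mxE.
  rewrite (reindex (@enum_rank G)) /=; last exact/onW_bij/enum_rank_bij.
  under eq_bigr do rewrite mxE enum_rankK.
  by move=> ->; rewrite scaler0.
by have := gal_independent c0 (x := (enum_val i : G)) isT; rewrite /c enum_valK.
Qed.

Hypothesis L_galois : galois 1%VS {:L}%VS.

(** As L/K is Galois, [gal_mx] is square up to this equality of its two sizes;
    it is kept rectangular to avoid casts. *)
Lemma card_galois_group : #|{: G}| = \dim {:L}.
Proof.
have := galois_dim L_galois; rewrite dimv1 divn1 => ->.
apply: eq_card => s; rewrite inE; apply/esym.
by rewrite [LHS]gal_kHom ?sub1v // k1AHom.
Qed.

Lemma gal_mx_row_full : row_full gal_mx.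
Proof. by rewrite /row_full (eqP gal_mx_row_free) card_galois_group. Qed.

(** The values of [twist c] on the basis of L are obtained from the coefficients
    by [gal_mx]; the next two lemmas cancel it on the right and on the left. *)
Lemma twist_mx (c : G -> T) :
  \row_j twist c (tens iota 1 (vbasis {:L})`_j) =
  (\row_i c (enum_val i)) *m map_mx (tens iota 1 : L -> T) gal_mx.
Proof.
apply/rowP=> j; rewrite !mxE /twist.
rewrite (reindex (@enum_val G predT)) /=; last exact/onW_bij/enum_val_bij.
by apply: eq_bigr => i _; rewrite !mxE galT_tens.
Qed.

Lemma twist_inj (c d : G -> T) :
  (forall l, twist c (tens iota 1 l) = twist d (tens iota 1 l)) -> c =1 d.
Proof.
move=> cd s; have [N MN1] := row_freeP gal_mx_row_free.
have /(congr1 (mulmx^~ (map_mx (tens iota 1 : L -> T) N))) :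
    (\row_i c (enum_val i)) *m map_mx (tens iota 1 : L -> T) gal_mx
    = (\row_i d (enum_val i)) *m map_mx (tens iota 1 : L -> T) gal_mx.
  by rewrite -!twist_mx; apply/rowP=> j; rewrite !mxE.
rewrite -!mulmxA -map_mxM MN1 map_mx1 !mulmx1.
by move/rowP/(_ (enum_rank s)); rewrite !mxE enum_rankK.
Qed.

(** With N a left inverse of [gal_mx], the coefficients of f are its values on
    the basis of L, multiplied by N. *)
Lemma linear_twist (f : 'End(T)) : exists c : G -> T, f =1 twist c.
Proof.
have [N NM1] := row_fullP gal_mx_row_full.
pose u := (\row_j f (tens iota 1 (vbasis {:L})`_j))
            *m map_mx (tens iota 1 : L -> T) N.
pose c (s : G) : T := u 0 (enum_rank s).
have cE (j : 'I_(\dim {:L})) : f (tens iota 1 (vbasis {:L})`_j)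
            = twist c (tens iota 1 (vbasis {:L})`_j).
  have /rowP/(_ j) := twist_mx c; rewrite !mxE => ->.
  have -> : \row_i c (enum_val i) = u.
    by apply/rowP=> i; rewrite mxE /c enum_valK.
  have <- : (u *m map_mx (tens iota 1 : L -> T) gal_mx) 0 j =
            f (tens iota 1 (vbasis {:L})`_j).
    by rewrite -mulmxA -map_mxM NM1 map_mx1 mulmx1 mxE.
  by rewrite mxE.
have cD : {morph twist c : x y / x + y}.
  by move=> x y; rewrite -big_split; apply: eq_bigr => s _;
     rewrite raddfD mulrDr.
have cZ a x : twist c (a *: x) = a *: twist c x.
  by rewrite scaler_sumr; apply: eq_bigr => s _; rewrite linearZ -scalerAr.
exists c => x.
have c0 : twist c 0 = 0 by rewrite -{1}(scale0r (0 : T)) cZ scale0r.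
rewrite (tensor_basis x) /tensor_lift linear_sum (big_morph _ cD c0).
by apply: eq_bigr => j _; rewrite tens_scale1 linearZ cZ /= cE.
Qed.

End TensorL.

(** * Automorphisms of the isocrystal that normalize L *)

Section EndomorphismAlgebra.
Variables (K Knr : fieldType) (iota : {rmorphism K -> Knr}).
Variables (w : discrete_valuation Knr) (q : nat) (sigma : frobenius w iota q).
Variable L : splittingFieldType K.
Local Notation T := (tensor iota L).
Local Notation G := (galois_group L).
Variable alpha : units T.
Local Notation D := (DK sigma alpha).
Local Notation W := (W sigma alpha).
Local Notation i_W := (W_incl sigma alpha).
Local Notation p_W := (W_proj sigma alpha).
Local Notation F := (frobT sigma (L := L)).

(** Both b and c are multiplied by s(alpha) / alpha under sigma, so c / b is
    fixed. *)
Lemma frobT_coef_multiple (b c : T) (s : G) : b \is a GRing.unit ->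
    F b * unit_val alpha = galT s (unit_val alpha) * b ->
    F c * unit_val alpha = galT s (unit_val alpha) * c ->
  exists l, c = tens iota 1 l * b.
Proof.
move=> Ub bW cW; have Ua := unit_valP alpha.
have [|l lE] := @frobT_fixed _ _ _ _ _ _ sigma (c / b).
  have UFb : F b \is a GRing.unit by apply: rmorph_unit.
  apply: (mulIr UFb); rewrite -rmorphM divrK //.
  apply: (mulIr Ua); rewrite cW -mulrA bW mulrCA divrK //.
by exists l; rewrite -lE divrK.
Qed.

Fact DK_twist_subproof (x : W) (y : T) :
  let f := (amull (unit_val (W_pair x).1 : T)
            \o linfun (galT (W_pair x).2))%VF in
  f (LK_F sigma alpha y) = LK_F sigma alpha (f y).
Proof.
case: x => -[b s] /= bs; have := bs; rewrite W_condE /= => /eqP bsE.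
rewrite !comp_lfunE !lfunE /= /LK_F !rmorphM /= frobT_galT.
by rewrite mulrA (mulrC (unit_val b)) -bsE mulrAC mulrC mulrA.
Qed.
Definition DK_twist (x : W) : D := DK_of (DK_twist_subproof x).

Lemma DK_twistE x (y : T) :
  DK_twist x y = unit_val (W_pair x).1 * galT (W_pair x).2 y.
Proof. by rewrite /DK_fun comp_lfunE !lfunE. Qed.

Lemma DK_mulE (f g : D) (y : T) : DK_fun (f * g) y = f (g y).
Proof. by rewrite /DK_fun comp_lfunE. Qed.

Lemma DK_addE (f g : D) (y : T) : DK_fun (f + g) y = f y + g y.
Proof. by rewrite /DK_fun add_lfunE. Qed.

Lemma DK_linearZ (f : D) c (y : T) : f (c *: y : T) = c *: DK_fun f y.
Proof. exact: linearZ. Qed.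

Lemma DK_1E (y : T) : DK_fun (1 : D) y = y.
Proof. by rewrite /DK_fun id_lfunE. Qed.

Lemma DK_twistM x y : DK_twist (x * y)%g = DK_twist x * DK_twist y.
Proof.
apply: DK_ext => z; rewrite DK_mulE !DK_twistE /=.
by rewrite rmorphM galTM mulrA.
Qed.

Lemma DK_twist1 : DK_twist 1%g = 1.
Proof. by apply: DK_ext => z; rewrite DK_1E DK_twistE /= galT1 mul1r. Qed.

Lemma DK_twist_unit x : DK_twist x \is a GRing.unit.
Proof.
apply/unitrP; exists (DK_twist x^-1%g).
by rewrite -!DK_twistM mulVg mulgV DK_twist1.
Qed.

Lemma DK_twist_emb x l :
  DK_twist x * DK_emb sigma alpha l =
  DK_emb sigma alpha ((p_W x : G) l) * DK_twist x.
Proof.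
apply: DK_ext => y; rewrite !DK_mulE !DK_embE !DK_twistE.
by rewrite rmorphM /= galT_tens mulrCA.
Qed.

Lemma DK_twist_induces x : induces (Units (DK_twist_unit x)) (p_W x).
Proof. by move=> l /=; rewrite DK_twist_emb mulrK ?DK_twist_unit. Qed.

Definition DKgrp_twist (x : W) : DKgrp sigma alpha :=
  MkDKgrp (asboolT (ex_intro _ _ (DK_twist_induces x))).

Lemma DKgrp_projE (u : DKgrp sigma alpha) s :
  induces (DKgrp_unit u) s -> DKgrp_proj sigma alpha u = s.
Proof. exact/induces_inj/DKgrp_projP. Qed.

(** An automorphism u inducing s satisfies u(l) = s(l) u(1) for l in L, hence
    u(x) = u(1) * s(x) by linearity.  The factor u(1) is a unit since the value
    1 is attained, and evaluating u F_alpha = F_alpha u at 1 shows that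
    (u(1), s) belongs to W(alpha). *)
Lemma induces_twist (u : units D) s : induces u s ->
  exists2 x : W, unit_val u = DK_twist x & p_W x = s.
Proof.
move=> us; pose b : T := DK_fun (unit_val u) 1; have Uu := unit_valP u.
have uE y : DK_fun (unit_val u) y = b * galT s y.
  move: y; apply: additive_ext => [y z|y z|a l].
  - exact: linearD.
  - by rewrite rmorphD mulrDr.
  have -> : tens iota a l = a *: DK_fun (DK_emb sigma alpha l) 1.
    by rewrite DK_embE mulr1 tens_scale1.
  rewrite DK_linearZ -DK_mulE.
  have -> : unit_val u * DK_emb sigma alpha l =
            DK_emb sigma alpha (s l) * unit_val u.
    by rewrite -us divrK.
  rewrite DK_mulE DK_embE -/b linearZ /= DK_embE mulr1 galT_tens.
  by rewrite mulrC -scalerAr.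
have Ub : b \is a GRing.unit.
  apply/unitrPr; exists (galT s (DK_fun (unit_val u)^-1 1)).
  by rewrite -uE -DK_mulE divrr // DK_1E.
have bs : W_cond sigma alpha (Units Ub, s).
  rewrite W_condE /=; have := DK_F (unit_val u) 1.
  by rewrite /LK_F rmorph1 mulr1 uE -/b mulrC => ->; rewrite mulrC.
exists (MkW bs) => //.
by apply: DK_ext => y; rewrite DK_twistE uE.
Qed.

(** [DKgrp_twist] is the natural map, from W(alpha) to the group in D_K(alpha);
    it is shown to be bijective and the isomorphism is its inverse. *)
Lemma extension_isom_DK_W :
  extension_isom (DKgrp_incl sigma alpha) (DKgrp_proj sigma alpha) i_W p_W.
Proof.
have tw_p x : DKgrp_proj sigma alpha (DKgrp_twist x) = p_W x.
  exact/DKgrp_projE/DK_twist_induces.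
have tw_inj : injective DKgrp_twist.
  move=> x y xy; have := congr1 (DKgrp_proj sigma alpha) xy.
  rewrite !tw_p => xy2.
  have /(congr1 (fun f : D => DK_fun f 1)) :=
    congr1 (fun u => unit_val (DKgrp_unit u)) xy.
  rewrite /= !DK_twistE !rmorph1 !mulr1 => xy1.
  apply: val_inj; rewrite /= [LHS]surjective_pairing [RHS]surjective_pairing.
  by congr (_, _) => //; apply: val_inj.
have /choice[th thK] (u : DKgrp sigma alpha) : exists x, DKgrp_twist x = u.
  have [x ux _] := induces_twist (DKgrp_projP u).
  by exists x; apply: val_inj; apply: val_inj.
exists th; split=> [u v||l|u].
- apply: tw_inj; rewrite thK; apply: val_inj; apply: val_inj.
  by rewrite /= DK_twistM -{1}[u]thK -{1}[v]thK.
- by exists DKgrp_twist => // x; apply: tw_inj.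
- apply: tw_inj; rewrite thK; apply: val_inj; apply: val_inj => /=.
  by apply: DK_ext => y; rewrite DK_embE DK_twistE /= galT1.
- by rewrite -tw_p thK.
Qed.

(** * The crossed product of a section of W *)

Section CrossedProductIsom.
Variable beta : G -> units T.
Hypothesis betaW : forall s, W_cond sigma alpha (beta s, s).
Local Notation b s := (unit_val (beta s)).

Lemma group_extension_W : group_extension i_W p_W.
Proof.
split=> [l m|//|l m|x|s].
- apply: val_inj => /=; congr (_, _); last by rewrite mulg1.
  by apply: val_inj; rewrite /= galT1 tensM mulr1.
- move/(congr1 (fun x => unit_val (W_pair x).1)) => /= /tens1_inj.
  exact: val_inj.
- split=> [|[l ->]] //; case: x => -[c s] cs /= s1; rewrite /W_proj /= in s1.
  have := cs; rewrite W_condE /= => /eqP csE.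
  have [|l lE] := @frobT_coef_multiple 1 (unit_val c) s (unitr1 _) _ csE.
    by rewrite s1 galT1 rmorph1 mulrC.
  have Ul : l \is a GRing.unit.
    rewrite unitfE; apply/eqP=> l0; move: (unit_valP c).
    by rewrite lE l0 rmorph0 mul0r unitr0.
  exists (Units Ul); apply: val_inj; rewrite /= s1; congr (_, _).
  by apply: val_inj; rewrite /= lE mulr1.
- by exists (MkW (betaW s)).
Qed.

(** beta_s s(beta_t) and beta_(st) are the coefficients of two elements of
    W(alpha) above st. *)
Lemma factor_set : exists a : G -> G -> L, forall s t,
  b s * galT s (b t) = tens iota 1 (a s t) * b (s * t)%g.
Proof.
suff /choice[a aE] (st : G * G) : exists l, b st.1 * galT st.1 (b st.2)
    = tens iota 1 l * b (st.1 * st.2)%g.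
  by exists (fun s t => a (s, t)) => s t; apply: (aE (s, t)).
case: st => s t /=; apply: (frobT_coef_multiple (s := (s * t)%g)).
  exact: unit_valP.
  by have := betaW (s * t)%g; rewrite W_condE => /eqP.
have := W_condP (MkW (betaW s) * MkW (betaW t))%g.
by rewrite W_condE => /eqP.
Qed.

Hypothesis beta1 : b 1%g = 1.

(** The cocycle identity compares the two ways of evaluating
    beta_s s(beta_t) st(beta_r), and beta_(str) may be cancelled. *)
Lemma cocycle_of_section : exists a : normalized_cocycle L, forall s t,
  b s * galT s (b t) = tens iota 1 (a s t) * b (s * t)%g.
Proof.
have [a aE] := factor_set.
have Ub s : b s \is a GRing.unit := unit_valP (beta s).
have aE1 s t l : b s * galT s (b t) = tens iota 1 l * b (s * t)%g -> a s t = l.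
  by rewrite aE => /(mulIr (Ub _))/tens1_inj.
have a_neq0 s t : a s t != 0.
  apply/eqP=> a0.
  have : b s * galT s (b t) \is a GRing.unit by rewrite unitrM Ub galT_unit.
  by rewrite aE a0 rmorph0 mul0r unitr0.
have aM (s t r : G) : s (a t r) * a s (t * r)%g = a s t * a (s * t)%g r.
  apply: (@tens1_inj _ _ iota L); apply: (mulIr (Ub (s * (t * r))%g)).
  rewrite !rmorphM /= -!mulrA -aE -galT_tens mulrCA -rmorphM -aE.
  by rewrite mulgA -aE mulrA -aE rmorphM galTM mulrA.
have a1 s : a 1%g s = 1.
  by apply: aE1; rewrite beta1 galT1 mul1g.
have ar1 s : a s 1%g = 1.
  by apply: aE1; rewrite beta1 rmorph1 mulg1 mulrC.
by exists (NormalizedCocycle a_neq0 aM a1 ar1).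
Qed.

Variable a : normalized_cocycle L.
Hypothesis aE : forall s t,
  b s * galT s (b t) = tens iota 1 (a s t) * b (s * t)%g.

Definition cp_DK (x : crossed_product a) : D :=
  \sum_s DK_emb sigma alpha (x s) * DK_twist (MkW (betaW s)).

Lemma cp_DKE x (y : T) :
  cp_DK x y = twist (fun s => tens iota 1 (x s) * b s) y.
Proof.
have D0 : DK_fun (0 : D) y = 0 by rewrite /DK_fun zero_lfunE.
rewrite /cp_DK /twist (big_morph _ (fun f g : D => DK_addE f g y) D0).
by apply: eq_bigr => s _; rewrite DK_mulE DK_embE DK_twistE mulrA.
Qed.

Lemma cp_DKD : {morph cp_DK : x y / x + y}.
Proof.
move=> x y; apply: DK_ext => z; rewrite DK_addE !cp_DKE -big_split.
by apply: eq_bigr => s _; rewrite {1}/cp_fun ffunE rmorphD !mulrDl.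
Qed.

Lemma cp_DK_mon l s (y : T) :
  cp_DK (cp_mon a l s) y = tens iota 1 l * b s * galT s y.
Proof.
rewrite cp_DKE /twist (bigD1 s) //= big1 ?addr0 /cp_fun ?ffunE ?eqxx //.
by move=> t ts; rewrite ffunE (negPf ts) rmorph0 !mul0r.
Qed.

Fact cp_DK_zmod : zmod_morphism cp_DK.
Proof. by move=> x y; apply: (addIr (cp_DK y)); rewrite -cp_DKD !subrK. Qed.

Fact cp_DK_monoid : monoid_morphism cp_DK.
Proof.
split=> [|x y].
  by apply: DK_ext => y; rewrite cp_DK_mon beta1 rmorph1 galT1 !mul1r DK_1E.
move: x; apply: cp_ext => [x z|x z|l s].
- by rewrite mulrDl cp_DKD.
- by rewrite cp_DKD mulrDl.
move: y; apply: cp_ext => [x z|x z|m t].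
- by rewrite mulrDr cp_DKD.
- by rewrite cp_DKD mulrDr.
apply: DK_ext => y; rewrite DK_mulE /GRing.mul /= cp_mul_mon !cp_DK_mon.
rewrite !rmorphM /= galTM galT_tens -!mulrA; congr (_ * _).
by rewrite [RHS]mulrCA; congr (_ * _); rewrite mulrA -aE mulrA.
Qed.

Fact cp_DK_scalable : scalable cp_DK.
Proof.
move=> k x; apply: DK_ext => y.
rewrite /DK_fun /= scale_lfunE -!/(DK_fun _ _) !cp_DKE scaler_sumr.
by apply: eq_bigr => s _; rewrite {1}/cp_fun ffunE tens1Z !scalerAl.
Qed.

HB.instance Definition _ := GRing.isZmodMorphism.Build _ _ cp_DK cp_DK_zmod.
HB.instance Definition _ := GRing.isMonoidMorphism.Build _ _ cp_DK cp_DK_monoid.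
HB.instance Definition _ :=
  GRing.isScalable.Build K _ _ *:%R cp_DK cp_DK_scalable.

(** The endomorphism determines its coefficients x_s beta_s, and beta_s is a
    unit. *)
Lemma cp_DK_inj : injective cp_DK.
Proof.
move=> x y xy; apply/ffunP=> s; apply: (@tens1_inj _ _ iota L).
apply: (mulIr (unit_valP (beta s))).
apply: (twist_inj (c := fun s => tens iota 1 (x s) * b s)
                  (d := fun s => tens iota 1 (y s) * b s)) => l.
by rewrite -!cp_DKE xy.
Qed.

Hypothesis L_galois : galois 1%VS {:L}%VS.

(** Expand f with coefficients c_s.  Comparing coefficients in
    f F_alpha = F_alpha f gives sigma(c_s) alpha = s(alpha) c_s, the equation
    solved by beta_s, so that c_s is in L beta_s. *)
Lemma cp_DK_surj (f : D) : exists x, cp_DK x = f.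
Proof.
have [c cE] := linear_twist L_galois (iso_lfun f).
have cW s : F (c s) * unit_val alpha = galT s (unit_val alpha) * c s.
  rewrite [LHS]mulrC [RHS]mulrC; apply/esym; move: s.
  (* Elements of L suffice to compare coefficients, and sigma fixes them. *)
  apply: twist_inj => l; have Fl : F (tens iota 1 l) = tens iota 1 l.
    by rewrite frobT_tens rmorph1.
  transitivity (twist c (LK_F sigma alpha (tens iota 1 l))).
    apply: eq_bigr => s _.
    by rewrite /LK_F Fl [in RHS]rmorphM mulrA.
  rewrite -cE -/(DK_fun _ _) DK_F /LK_F /DK_fun cE rmorph_sum mulr_sumr.
  apply: eq_bigr => s _.
  by rewrite [in LHS]rmorphM /= frobT_galT Fl mulrA.
have /choice[x xE] s : exists l, c s = tens iota 1 l * b s.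
  apply: (frobT_coef_multiple (s := s)); rewrite ?unit_valP //.
  by have := betaW s; rewrite W_condE => /eqP.
exists [ffun s => x s]; apply: DK_ext => y; rewrite cp_DKE [RHS]cE.
by apply: eq_bigr => s _; rewrite /cp_fun ffunE -xE.
Qed.

Lemma crossed_product_isom :
  exists f : {lrmorphism crossed_product a -> D}, bijective f.
Proof.
exists cp_DK; have /choice[g gK] := cp_DK_surj.
by exists g => // x; apply: cp_DK_inj.
Qed.

End CrossedProductIsom.
End EndomorphismAlgebra.

Theorem theorem1p4p1
  (K : fieldType) (v : discrete_valuation K) (q : nat)
  (K_local : local_field v q)
  (Knr : fieldType) (w : discrete_valuation Knr) (iota : {rmorphism K -> Knr})
  (Knr_completion : completed_maximal_unramified v w iota)
  (sigma : frobenius w iota q)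
  (L : splittingFieldType K) (L_galois : galois 1%VS {:L}%VS)
  (alpha : units (tensor iota L))
  (beta : galois_group L -> units (tensor iota L))
  (betaE : forall s : galois_group L,
     frobT sigma (unit_val (beta s)) / unit_val (beta s) =
     galT s (unit_val alpha) / unit_val alpha)
  (beta1 : unit_val (beta 1%g) = 1) :
  (exists2 a : normalized_cocycle L,
     (forall s t : galois_group L,
        tens iota 1 (a s t) =
        galT s (unit_val (beta t)) * (unit_val (beta (s * t)%g))^-1
          * unit_val (beta s)) &
     exists f : {lrmorphism crossed_product a -> DK sigma alpha},
       bijective f) /\
  [/\ group_extension (DKgrp_incl sigma alpha) (DKgrp_proj sigma alpha),
      group_extension (W_incl sigma alpha) (W_proj sigma alpha)
    & extension_isom (DKgrp_incl sigma alpha) (DKgrp_proj sigma alpha)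
                     (W_incl sigma alpha) (W_proj sigma alpha)].
Proof.
have betaW s : W_cond sigma alpha (beta s, s) by apply/eqP/betaE.
have W_ext := group_extension_W betaW.
have isom := extension_isom_DK_W sigma alpha.
split; last by split=> //; apply: group_extension_of_isom isom W_ext.
have [a aE] := cocycle_of_section betaW beta1.
have [f f_bij] := crossed_product_isom betaW beta1 aE L_galois.
exists a; last by exists f.
move=> s t; rewrite mulrAC [_ * unit_val (beta s)]mulrC aE.
by rewrite mulrK ?unit_valP.
Qed.
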